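(* Let $X$ be a real inner-product space with induced norm $\|\cdot\|$ and inner product written $u^\top v$. Let $L>0$, let $f:X\to\mathbb{R}$ be convex and $L$-Lipschitz continuously differentiable, and let $\psi:X\to\mathbb{R}\cup\{+\infty\}$ be convex, proper and closed. Put $F=f+\psi$, and assume that the solution set $\Omega=\arg\min_{x\in X}F(x)$ is nonempty, with $F^*=\min_{x\in X} F(x)$. Let $\gamma\in(0,1]$, $C_2\in\left(0,\frac{2-\gamma}{L}\right]$ and $C_1\ge C_2$. Let $x_0\in X$ be the initial point and let $(x_k)_{k\ge0}$ be generated by $$x_{k+1}=x_k+d_k,\qquad d_k=\arg\min_{d\in X}\ \nabla f(x_k)^\top d+\frac{1}{2\alpha_k}\|d\|^2+\psi(x_k+d),\qquad k=0,1,2,\dots,$$ where for every $k\ge 0$ the parameter $\alpha_k$ is such that $$\alpha_k\in[C_2,C_1]\quad\text{and}\quad F(x_k+d_k)\le F(x_k)-\frac{\gamma}{2\alpha_k}\|d_k\|^2 .$$ Then $F(x_k)$ converges to $F^*$ at rate $o(1/k)$, that is, $\lim_{k\to\infty}k\,(F(x_k)-F^* )=0$. Moreover, the sequence $(x_k)$ is bounded.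
   Context: A function $f:X\to\mathbb{R}$ is $L$-Lipschitz continuously differentiable if it is differentiable with gradient $\nabla f(x)\in X$ at every $x\in X$ (the vector representing the derivative through the inner product) and $\|\nabla f(x)-\nabla f(y)\|\le L\|x-y\|$ for all $x,y\in X$. It is a standing assumption that $\psi$ is such that the proximal problem $\min_{x}\psi(x)+\frac{1}{2\lambda}\|x-y\|^2$ can be solved for every $y\in X$ and $\lambda>0$; in particular the minimizer $d_k$ exists, and it is unique by strong convexity. *)

(* Defs.v *)
From HB Require Import structures.
From mathcomp Require Import all_boot all_order all_algebra.
From mathcomp Require Import all_classical all_reals all_analysis.
Export Order.TTheory GRing.Theory Num.Theory.
Export numFieldNormedType.Exports.

Set Implicit Arguments.
Unset Strict Implicit.
Unset Printing Implicit Defensive.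

Local Open Scope classical_set_scope.
Local Open Scope ring_scope.

(* Together with [dot], the norm [`| _ |] of [X] makes [X] a real inner-product
   space; neither completeness nor finite dimension is assumed. *)
Definition induced_norm (R : realType) (X : normedModType R)
    (dot : {dot X for idfun}) : Prop :=
  forall u : X, `|u| = Num.sqrt (dot u u).

Definition is_gradient (R : realType) (X : normedModType R)
    (dot : {dot X for idfun}) (f : X -> R) (g : X -> X) : Prop :=
  forall x : X, differentiable f x /\ forall h : X, 'd f x h = dot (g x) h.

(* The library's [convex_function] is for real-valued functions only. With the
   convention [0 * +oo = 0], the cases [t = 0] and [t = 1] are harmless for
   functions that never take the value [-oo]. *)
Definition econvex (R : realType) (X : normedModType R)
    (g : X -> \bar R) : Prop :=
  forall (t : R) (x y : X), 0 <= t <= 1 ->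
    (g (t *: x + (1 - t) *: y)%R <= t%:E * g x + (1 - t)%:E * g y)%E.

Definition proper_function (R : realType) (X : normedModType R)
    (g : X -> \bar R) : Prop :=
  (forall x, g x != -oo%E) /\ exists x, g x != +oo%E.

Definition epigraph (R : realType) (X : normedModType R)
    (g : X -> \bar R) : set (X * R) :=
  [set p | (g p.1 <= p.2%:E)%E].

Definition closed_function (R : realType) (X : normedModType R)
    (g : X -> \bar R) : Prop :=
  closed (epigraph g).

Definition argmin (R : realType) (X : normedModType R)
    (g : X -> \bar R) : set X :=
  [set x | forall y, (g x <= g y)%E].

Definition prox_objective (R : realType) (X : normedModType R)
    (psi : X -> \bar R) (lambda : R) (y x : X) : \bar R :=
  (psi x + ((2 * lambda)^-1 * `|x - y| ^+ 2)%:E)%E.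

Definition prox_solvable (R : realType) (X : normedModType R)
    (psi : X -> \bar R) : Prop :=
  forall (y : X) (lambda : R), 0 < lambda ->
    argmin (prox_objective psi lambda y) !=set0.

Definition step_objective (R : realType) (X : normedModType R)
    (dot : {dot X for idfun}) (gradf : X -> X) (psi : X -> \bar R)
    (alpha : R) (x d : X) : \bar R :=
  ((dot (gradf x) d + (2 * alpha)^-1 * `|d| ^+ 2)%:E + psi (x + d)%R)%E.

(* Main.v *)
(* Convexity of f, the Lipschitz bound on its gradient and the optimality of the
   step give, for a minimizer x* and v_k = F(x_k) - F*,
     2 alpha_k v_(k+1) + |x_(k+1) - x*|^2
       <= |x_k - x*|^2 + 2 alpha_k L |d_k|^2.
   The last term need not be absorbed by alpha_k, which may exceed 2/L: the
   decrease condition makes |d_k|^2 bounded by a constant times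
   v_k - v_(k+1), so it telescopes. Hence |x_k - x*| is bounded and
   sum v_k < +oo; as v_k is nonincreasing, k v_k tends to 0. *)
Require Import Defs.
From mathcomp Require Import all_boot all_order all_algebra.
From mathcomp Require Import all_classical all_reals all_analysis.
From mathcomp Require Import lra zify.

Local Open Scope classical_set_scope.
Local Open Scope ring_scope.

Set Implicit Arguments.
Unset Strict Implicit.

Lemma sqr_norm_dot (R : realType) (X : normedModType R) (dot : {dot X for idfun})
    (hX : induced_norm dot) (u : X) : `|u| ^+ 2 = dot u u.
Proof.
rewrite hX sqr_sqrtr //; have [->|u0] := eqVneq u 0; first by rewrite linear0r.
by rewrite ltW // neq0_dnorm_gt0.
Qed.

Lemma dotC (R : realType) (X : normedModType R) (dot : {dot X for idfun})
    (u v : X) : dot u v = dot v u.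
Proof. by rewrite (hermC dot) expr0 mul1r. Qed.

Lemma dotZr (R : realType) (X : normedModType R) (dot : {dot X for idfun})
    (a : R) (u v : X) : dot u (a *: v) = a * dot u v.
Proof. exact: linearZ. Qed.

Lemma sqr_normDZ (R : realType) (X : normedModType R) (dot : {dot X for idfun})
    (hX : induced_norm dot) (u v : X) (t : R) :
  `|u + t *: v| ^+ 2 = `|u| ^+ 2 + 2 * t * dot u v + t ^+ 2 * `|v| ^+ 2.
Proof.
rewrite !(sqr_norm_dot hX) linearDl !linearDr /= !dotZr.
by rewrite !(dotC dot (t *: v)) !dotZr; lra.
Qed.

(** Expanding [0 <= |u - L v|^2] gives [2 L (dot u v) <= |u|^2 + L^2 |v|^2 <= 2 L^2 |v|^2], so
    Cauchy-Schwarz is not invoked. *)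
Lemma dot_le_of_norm_le (R : realType) (X : normedModType R)
    (dot : {dot X for idfun}) (hX : induced_norm dot) (L : R) (u v : X) :
  0 < L -> `|u| <= L * `|v| -> dot u v <= L * `|v| ^+ 2.
Proof.
move=> L0 uv.
have uv2 : `|u| ^+ 2 <= L ^+ 2 * `|v| ^+ 2.
  by rewrite -exprMn lerXn2r ?nnegrE ?mulr_ge0// ltW.
have : 0 <= `|u + (- L) *: v| ^+ 2 by rewrite sqr_ge0.
rewrite (sqr_normDZ hX) => h.
by rewrite -(ler_pM2l L0) mulrA -expr2; lra.
Qed.

(** The derivative at [x] along [y - x] is a limit of difference quotients over [t > 0], and
    convexity bounds each of them with [t <= 1] by [f y - f x]. *)
Lemma convex_gradient_le (R : realType) (X : normedModType R)
    (dot : {dot X for idfun}) (f : X -> R) (g : X -> X) (x y : X) :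
  convex_function [set: X] f -> is_gradient dot f g ->
  f x + dot (g x) (y - x) <= f y.
Proof.
move=> cf fg; have [df dfE] := fg x; rewrite -dfE -deriveE// -lerBrDl.
have : h^-1 *: ((f \o shift x) (h *: (y - x)) - f x) @[h --> 0^'] -->
    'D_(y - x) f x by exact: diff_derivable.
move/cvg_dnbhs_at_right => /cvgr_to_le; apply.
near=> t.
have t0 : 0 < t by [].
have t1 : t <= 1 by near: t; exact: nbhs_right_le.
have := cf (Itv01 (ltW t0) t1) y x; rewrite !inE => /(_ I I).
rewrite convRE /= => h.
rewrite -[X in X <= _]/(t^-1 * (f (t *: (y - x) + x) - f x)).
rewrite mulrC ler_pdivrMr//.
have -> : t *: (y - x) + x = t *: y + (1 - t) *: x.
  by rewrite scalerBr scalerBl scale1r -addrA; congr (_ + _); rewrite addrC.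
apply: le_trans (lerB h (lexx _)) _.
rewrite /unstable.onem; lra.
Unshelve. all: by end_near. Qed.

(* The constant L instead of the sharp L / 2 comes from applying the gradient
   inequality at x + d; it avoids a mean value argument. *)
Lemma convex_lipschitz_le (R : realType) (X : normedModType R)
    (dot : {dot X for idfun}) (hX : induced_norm dot) (L : R) (hL : 0 < L)
    (f : X -> R) (g : X -> X) (x d : X) :
  convex_function [set: X] f -> is_gradient dot f g -> L.-lipschitz g ->
  f (x + d) <= f x + dot (g x) d + L * `|d| ^+ 2.
Proof.
move=> cf fg lg.
have := convex_gradient_le (x + d) x cf fg.
have : `|g (x + d) - g x| <= L * `|d|.
  by have /= := lg (x + d, x); rewrite [x + d]addrC addrK; apply.
move=> /(dot_le_of_norm_le hX hL).
rewrite linearBl opprD addNKr linearN /=; lra.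
Qed.

Lemma ge0_of_linear_quadratic (R : realType) (a b : R) :
  (forall t, 0 < t <= 1 -> 0 <= t * a + t ^+ 2 * b) -> 0 <= a.
Proof.
move=> h; rewrite leNgt; apply/negP => a0.
(* At [t = c] the expression is [c * (a + c * b)], and [c * b < - a]; the summand [|a|] ensures
   [c <= 1]. *)
pose c := - a / (1 + `|a| + `|b|).
have den : 0 < 1 + `|a| + `|b| by rewrite -addrA ltr_pwDl// addr_ge0.
have c0 : 0 < c by rewrite divr_gt0// oppr_gt0.
have cE : c * (1 + `|a| + `|b|) = - a by rewrite divfK// gt_eqF.
have c1 : c <= 1.
  by rewrite ler_pdivrMr// mul1r ltr0_norm//; have := normr_ge0 b; lra.
have := h c; rewrite c0 c1 => /(_ isT).
have : b <= `|b| by exact: ler_norm.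
have : 0 <= `|a| by [].
nra.
Qed.

(** First-order condition: [- (g x + a^-1 d)] is a subgradient of [psi] at [x + d]. Moving from [d]
    a fraction [t] of the way towards [y] cannot lower the objective, so the coefficient of [t] is
    nonnegative. *)
Lemma prox_step_optimality (R : realType) (X : normedModType R)
    (dot : {dot X for idfun}) (hX : induced_norm dot) (g : X -> X)
    (psi : X -> \bar R) (a p q : R) (x d y : X) :
  econvex psi -> 0 < a -> argmin (step_objective dot g psi a x) d ->
  psi (x + d) = p%:E -> psi y = q%:E ->
  p <= q + dot (g x) (y - (x + d)) + a^-1 * dot d (y - (x + d)).
Proof.
move=> cpsi a0 dmin pE qE; set w := y - (x + d).
suff : 0 <= q - p + dot (g x) w + a^-1 * dot d w by lra.
apply: (@ge0_of_linear_quadratic _ _ ((2 * a)^-1 * `|w| ^+ 2)) => t /andP[t0 t1].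
have := dmin (d + t *: w); rewrite /step_objective pE.
have -> : x + (d + t *: w) = t *: y + (1 - t) *: (x + d).
  by rewrite addrA /w scalerBr scalerBl scale1r addrCA.
have /cpsi h : 0 <= t <= 1 by rewrite ltW.
move=> /le_trans /(_ (leeD2l _ (h _ _))); rewrite pE qE.
rewrite -!EFinM -!EFinD lee_fin (sqr_normDZ hX) linearDr /= dotZr.
have -> : (2 * a)^-1 = a^-1 / 2 by rewrite invfM mulrC.
lra.
Qed.

(** By monotonicity the terms from [N] to [n] sum to at least [(n + 1 - N) u_n], which is at least
    half of [(n + 1) u_n] once [n >= 2 N]; this tail is small. *)
Lemma nonincreasing_summable_cvg (R : realType) (u : nat -> R) (S : R) :
  (forall n, 0 <= u n) -> {homo u : m n / (m <= n)%N >-> n <= m} ->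
  (forall n, \sum_(0 <= k < n) u k <= S) ->
  (fun n => n.+1%:R * u n) @ \oo --> 0.
Proof.
move=> u0 ui uS.
have : cvgn (series u).
  apply: nondecreasing_is_cvgn; last by exists S => _ [n _ <-]; exact: uS.
  by apply/nondecreasing_seqP => n; rewrite seriesSr/= lerDl.
move=> cu; apply/cvgr0Pnorm_le => e e0.
have /cvgrPdist_lt /(_ _ (divr_gt0 e0 (ltr0n _ 2))) [N _ /(_ N (leqnn N))] := cu.
rewrite /= => hN.
have ser_le : forall n, series u n <= limn (series u).
  apply: nondecreasing_cvgn_le => //.
  by apply/nondecreasing_seqP => n; rewrite seriesSr/= lerDl.
near=> n.
have nN : (N.*2 <= n)%N by near: n; exists N.*2.
have Nn : (N <= n.+1)%N by rewrite (leq_trans _ (leqW nN))// -addnn leq_addr.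
rewrite ger0_norm ?mulr_ge0//.
have tail : (n.+1 - N)%:R * u n <= series u n.+1 - series u N.
  rewrite sub_series_geq// mulr_natl -sumr_const_nat.
  by apply: ler_sum_nat => k /andP[_ kn]; apply: ui.
have half : n.+1%:R <= 2 * (n.+1 - N)%:R :> R.
  by rewrite -natrM ler_nat mulnBr mul2n -addnn mul2n leq_subRL; lia.
have := ser_le n.+1; have := ler_norm (limn (series u) - series u N).
have := ler_wpM2r (u0 n) half; lra.
Unshelve. all: by end_near. Qed.

Lemma prox_step_descent (R : realType) (X : normedModType R)
    (dot : {dot X for idfun}) (hX : induced_norm dot) (L : R) (hL : 0 < L)
    (f : X -> R) (g : X -> X) (psi : X -> \bar R) (a p q : R) (x d y : X) :
  convex_function [set: X] f -> is_gradient dot f g -> L.-lipschitz g ->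
  econvex psi -> 0 < a -> argmin (step_objective dot g psi a x) d ->
  psi (x + d) = p%:E -> psi y = q%:E ->
  2 * a * (f (x + d) + p - (f y + q)) + `|x + d - y| ^+ 2
    <= `|x - y| ^+ 2 + 2 * a * L * `|d| ^+ 2.
Proof.
move=> cf fg lg cpsi a0 dmin pE qE.
have opt := prox_step_optimality hX cpsi a0 dmin pE qE.
have grad := convex_gradient_le x y cf fg.
have desc := convex_lipschitz_le hX hL x d cf fg lg.
pose w := y - (x + d); rewrite -/w in opt.
have dotw : dot (g x) w = dot (g x) (y - x) - dot (g x) d.
  by rewrite /w opprD addrA linearB.
have pyth : `|x - y| ^+ 2 = `|x + d - y| ^+ 2 + 2 * dot d w + `|d| ^+ 2.
  have := sqr_normDZ hX w d 1; rewrite scale1r (dotC dot w d).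
  have -> : w + d = y - x by rewrite /w opprD addrA subrK.
  by rewrite [`|w|]distrC [`|y - x|]distrC => ->; lra.
have d0 : 0 <= `|d| ^+ 2 by rewrite sqr_ge0.
(* The gradient terms of the three inequalities cancel; [pyth] then turns [2 (dot d w)] into a
   difference of squared distances. *)
have gap : f (x + d) + p - (f y + q) <= L * `|d| ^+ 2 + a^-1 * dot d w by lra.
have := ler_wpM2l (ltW a0) gap.
by rewrite [leRHS]mulrDr mulVKf ?gt_eqF//; lra.
Qed.

(** The competitor [y - x] has a finite objective, even if [psi x] is infinite. *)
Lemma step_psi_fin_num (R : realType) (X : normedModType R)
    (dot : {dot X for idfun}) (g : X -> X) (psi : X -> \bar R) (a : R)
    (x d y : X) :
  proper_function psi -> argmin (step_objective dot g psi a x) d ->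
  psi y \is a fin_num -> psi (x + d) \is a fin_num.
Proof.
move=> [psiN _] dmin yfin; rewrite fin_numE psiN /=.
have := dmin (y - x); rewrite /step_objective subrKC.
by case: (psi (x + d)) => //; rewrite -(fineK yfin).
Qed.

Theorem theorem5 (R : realType) (X : normedModType R) (dot : {dot X for idfun})
    (hX : induced_norm dot)
    (L : R) (hL : 0 < L)
    (f : X -> R) (gradf : X -> X)
    (hf_convex : convex_function [set: X] f)
    (hf_grad : is_gradient dot f gradf)
    (hf_lip : L.-lipschitz gradf)
    (psi : X -> \bar R)
    (hpsi_convex : econvex psi) (hpsi_proper : proper_function psi)
    (hpsi_closed : closed_function psi) (hpsi_prox : prox_solvable psi)
    (F : X -> \bar R) (hF : forall x, F x = ((f x)%:E + psi x)%E)
    (hOmega : argmin F !=set0)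
    (Fstar : \bar R) (hFstar : exists2 xs, argmin F xs & F xs = Fstar)
    (gamma : R) (hgamma : 0 < gamma <= 1)
    (C2 : R) (hC2 : 0 < C2 <= (2 - gamma) / L)
    (C1 : R) (hC1 : C2 <= C1)
    (x d : nat -> X) (alpha : nat -> R)
    (hx : forall k, x k.+1 = x k + d k)
    (hd : forall k,
      argmin (step_objective dot gradf psi (alpha k) (x k)) (d k))
    (halpha : forall k, C2 <= alpha k <= C1)
    (hdecr : forall k,
      (F (x k + d k)%R
         <= F (x k) - (gamma / (2 * alpha k) * `|d k| ^+ 2)%:E)%E) :
  (fun k : nat => k%:R%:E * (F (x k) - Fstar))%E @ \oo --> 0%E
  /\ bounded_set (range x).
Proof.
have [xs xs_min FxsE] := hFstar.
have gamma0 : 0 < gamma by case/andP: hgamma.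
have C20 : 0 < C2 by case/andP: hC2.
have C10 : 0 < C1 by exact: lt_le_trans hC1.
have alpha0 k : 0 < alpha k by case/andP: (halpha k) => h _; exact: lt_le_trans h.
have psi_xs : psi xs \is a fin_num.
  have [psiN [z psiz]] := hpsi_proper; rewrite fin_numE psiN /=.
  have := xs_min z; rewrite !hF; case: (psi xs) => //.
  by case: (psi z) (psiN z) psiz.
pose q := fine (psi xs); have qE : psi xs = q%:E by rewrite fineK.
have FstarE : Fstar = (f xs + q)%:E by rewrite -FxsE hF qE.
(* The starting value F (x 0) may be infinite: every estimate is made from
   x 1 on. *)
pose p k := fine (psi (x k.+1)).
have pE k : psi (x k.+1) = (p k)%:E.
  by rewrite fineK// hx (step_psi_fin_num hpsi_proper (hd k) psi_xs).
(* Index shift: [v k], and below [e k] and [D k], belong to the iterate [x k.+1]. *)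
pose v k := f (x k.+1) + p k - (f xs + q).
have FE k : F (x k.+1) = (f (x k.+1) + p k)%:E by rewrite hF pE.
have v_ge0 k : 0 <= v k.
  by have := xs_min (x k.+1); rewrite FE FxsE FstarE lee_fin subr_ge0.
pose e k := `|d k.+1| ^+ 2.
have e_ge0 k : 0 <= e k by rewrite sqr_ge0.
have v_decr k : gamma * e k <= 2 * C1 * (v k - v k.+1).
  have := hdecr k.+1; rewrite -hx !FE -EFinB lee_fin => h.
  have [_ aC1] := andP (halpha k.+1).
  have {}h : gamma * e k / (2 * alpha k.+1) <= v k - v k.+1.
    by rewrite mulrAC /v /e; lra.
  have vv : 0 <= v k - v k.+1.
    by apply: le_trans h; rewrite divr_ge0 ?mulr_ge0// ltW.
  move: h; rewrite ler_pdivrMr ?mulr_gt0// => /le_trans; apply.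
  by rewrite mulrC; apply: ler_wpM2r => //; lra.
have v_noninc k : v k.+1 <= v k.
  rewrite -subr_ge0 -(pmulr_rge0 _ (_ : 0 < 2 * C1)) ?mulr_gt0//.
  by apply: le_trans (v_decr k); rewrite mulr_ge0// ltW.
pose D k := `|x k.+1 - xs| ^+ 2.
(* Product of [2 * C1 * L], which bounds the coefficient of [e k], and [2 * C1 / gamma] from
   [v_decr]. *)
pose K := 4 * C1 ^+ 2 * L / gamma.
have step k : 2 * C2 * v k.+1 + D k.+1 <= D k + K * (v k - v k.+1).
  have := prox_step_descent hX hL hf_convex hf_grad hf_lip hpsi_convex
    (alpha0 k.+1) (hd k.+1) (etrans (congr1 psi (esym (hx k.+1))) (pE k.+1)) qE.
  rewrite -hx -/(v k.+1) -/(D k.+1) -/(D k) -/(e k) => h.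
  have [aC2 aC1] := andP (halpha k.+1).
  have h1 : 2 * C2 * v k.+1 <= 2 * alpha k.+1 * v k.+1.
    by apply: ler_wpM2r => //; lra.
  have h2 : 2 * alpha k.+1 * L * e k <= 2 * C1 * L * e k.
    by apply: ler_wpM2r => //; apply: ler_wpM2r; [exact: ltW | lra].
  have h3 : 2 * C1 * L * e k <= K * (v k - v k.+1).
    rewrite /K [leRHS]mulrAC ler_pdivlMr//.
    have CL : 0 <= 2 * C1 * L by rewrite !mulr_ge0// ltW.
    by have := ler_wpM2l CL (v_decr k); lra.
  lra.
have K0 : 0 <= K by rewrite divr_ge0 ?mulr_ge0 ?sqr_ge0// ltW.
(* The last summand pays for the term [v 0], which no instance of [step] bounds. *)
pose M := D 0%N + K * v 0%N + 2 * C2 * v 0%N.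
have potential n : 2 * C2 * (\sum_(0 <= k < n.+1) v k) + D n + K * v n <= M.
  elim: n => [|n IHn]; first by rewrite big_nat1 /M; lra.
  by rewrite big_nat_recr//=; have := step n; lra.
have D_ge0 n : 0 <= D n by rewrite sqr_ge0.
have Kv n : 0 <= K * v n by rewrite mulr_ge0.
split.
  have v_cvg : (fun n => n.+1%:R * v n) @ \oo --> 0.
    apply: (@nonincreasing_summable_cvg _ _ (M / (2 * C2))) => //.
      by apply/nonincreasing_seqP.
    move=> n; rewrite ler_pdivlMr ?mulr_gt0// mulrC.
    have := potential n; rewrite big_nat_recr//= => h.
    have : 0 <= 2 * C2 * v n by rewrite !mulr_ge0// ltW.
    by have := D_ge0 n; have := Kv n; lra.
  (* Dropping the index 0 leaves only finite values of [F]. *)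
  rewrite -(cvg_shiftS _).
  have -> : [sequence (n.+1%:R%:E * (F (x n.+1) - Fstar))%E]_n
            = (fun n => (n.+1%:R * v n)%:E).
    by apply/funext => n /=; rewrite FE FstarE -EFinB -EFinM.
  by apply: (@cvg_EFin _ _ _ _ _ 0) => //; exact: nearW.
(* The norm of [x 0] covers the index 0; for the others, [s ^+ 2 <= M] gives [s <= 1 + M] without a
   square root. *)
exists (1 + M + `|xs| + `|x 0%N|); split; first exact: num_real.
move=> B /ltW MB _ [n _ <-] /=; apply: le_trans MB.
have M0 : 0 <= M by rewrite !addr_ge0// mulr_ge0// mulr_ge0// ltW.
case: n => [|n]; first by have := normr_ge0 xs; lra.
have DM : `|x n.+1 - xs| ^+ 2 <= M.
  have := potential n; have := Kv n; rewrite -/(D n).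
  have : 0 <= 2 * C2 * (\sum_(0 <= k < n.+1) v k).
    by rewrite mulr_ge0 ?sumr_ge0// mulr_ge0// ltW.
  lra.
have : `|x n.+1 - xs| <= 1 + M by nra.
have := ler_normD (x n.+1 - xs) xs; rewrite subrK.
by have := normr_ge0 (x 0%N); lra.
Qed.
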